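(* Assume that $\epsilon\in(0,1]$, $C\in\mathcal X$ and a probability measure $\nu$ on $(\mathsf X,\mathcal X)$ satisfy $\nu(C)=1$ and $P(x,A)\ge\epsilon\,\nu(A)$ for all $x\in C$, $A\in\mathcal X$. Let $\{r(n)\}_{n\ge0}$ be a (non-negative) sequence such that, for some $K$, $r(n+m)\le K r(n)r(m)$ for all $(n,m)\in\mathbb N\times\mathbb N$. Let $g:\mathsf X\to[1,\infty)$ be a measurable function, and for $x\in\mathsf X$ define $$W_{r,g}(x)=\tilde{\mathbb E}_x\left[\sum_{k=1}^{\tau}r(k)g(X_k)\right].$$ Then, for any $x\in\mathsf X$, $$\check{\mathbb E}_{\check\delta_x}\left[\sum_{k=0}^{\check\sigma}r(k)g(X_k)\right]\le r(0)g(x)+W_{r,g}(x)\mathbf 1_{C^c}(x)+\epsilon^{-1}(1-\epsilon)\,K\,\Big(\sup_C W_{r,g}\Big)\,\check{\mathbb E}_{\check\delta_x}[r(\check\sigma)].$$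
   Context: $P$ is the transition kernel of a positive Harris recurrent Markov chain on a measurable space $(\mathsf X,\mathcal X)$ with countably generated $\mathcal X$. Residual kernel: $Q(x,A)=(1-\epsilon\mathbf 1_C(x))^{-1}\{P(x,A)-\epsilon\mathbf 1_C(x)\nu(A)\}$ if $\epsilon\mathbf 1_C(x)<1$, and $Q(x,A)=\delta_x(A)$ if $\epsilon\mathbf 1_C(x)=1$. $\tilde{\mathbb E}_x$ is the expectation for a Markov chain $\{X_n\}_{n\ge0}$ with kernel $Q$ started at $x$; $\tau=\inf\{k\ge1:X_k\in C\}$. Split chain: on $\mathsf X\times\{0,1\}$ define the kernel $\check P$ by $\check P(x,0;A\times\{0\})=\int_A Q(x,dy)\{1-\epsilon\mathbf 1_C(y)\}$, $\check P(x,0;A\times\{1\})=\epsilon Q(x,A\cap C)$, $\check P(x,1;A\times\{0\})=\int_A\nu(dy)\{1-\epsilon\mathbf 1_C(y)\}$, $\check P(x,1;A\times\{1\})=\epsilon\nu(A\cap C)$. For a probability $\mu$ on $\mathsf X$ let $\check\mu(A\times\{0\})=\int_A\{1-\epsilon\mathbf 1_C(y)\}\mu(dy)$, $\check\mu(A\times\{1\})=\epsilon\mu(A\cap C)$; $\check\delta_x$ is this measure for $\mu=\delta_x$. $\check{\mathbb E}_{\check\mu}$ is the expectation for the Markov chain $\{(X_n,d_n)\}_{n\ge0}$ with initial distribution $\check\mu$ and kernel $\check P$. $\check\sigma=\inf\{k\ge0:d_k=1\}$. *)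

(* Defs.v *)
From HB Require Import structures.
From mathcomp Require Import all_boot all_order all_algebra.
From mathcomp Require Import all_classical all_reals all_analysis.

Set Implicit Arguments.
Unset Strict Implicit.
Unset Printing Implicit Defensive.
Import Order.TTheory GRing.Theory Num.Theory.
Import numFieldNormedType.Exports.

Local Open Scope classical_set_scope.
Local Open Scope ring_scope.
Local Open Scope ereal_scope.

Definition countably_generated (d : measure_display) (T : measurableType d) :=
  exists G : nat -> set T, @measurable d T = <<s range G >>.

(* [Z] is a Markov chain (for its natural filtration) with initial law [mu] and
   transition kernel [K] under [Pr]; the last clause says that [K (Z n) A] is a
   version of the conditional probability of [Z n.+1 \in A] given
   [sigma(Z 0, ..., Z n)].  Only the values of [mu] and [K x] on measurable
   sets are constrained, so plain set functions suffice. *)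
Definition markov_chain (dO d : measure_display) (Om : measurableType dO)
    (T : measurableType d) (R : realType) (Pr : probability Om R)
    (mu : set T -> \bar R) (K : T -> set T -> \bar R) (Z : nat -> Om -> T) :=
  [/\ forall n, measurable_fun setT (Z n),
      forall A, measurable A -> Pr (Z 0%N @^-1` A) = mu A
    & forall n B A, g_sigma_preimage (fun i : 'I_n.+1 => Z i) B ->
        measurable A ->
        Pr (B `&` Z n.+1 @^-1` A) = \int[Pr]_(w in B) K (Z n w) A].

Section harris.
Context (d : measure_display) (X : measurableType d) (R : realType).
Variable P : R.-pker X ~> X.

(* [Phi] holds of the law of the chain with kernel [P] started at [x]: a
   statement about the law, made for every realization of the chain. *)
Definition for_chain_from (x : X)
    (Phi : forall (dO : measure_display) (Om : measurableType dO),
      probability Om R -> (nat -> Om -> X) -> Prop) : Prop :=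
  forall (dO : measure_display) (Om : measurableType dO)
    (Pr : probability Om R) (Z : nat -> Om -> X),
    markov_chain Pr \d_x (fun y A => P y A) Z -> Phi dO Om Pr Z.

Definition irreducibility_measure (phi : set X -> \bar R) :=
  forall A, measurable A -> 0 < phi A -> forall x,
    for_chain_from x (fun dO Om Pr Z =>
      0 < Pr [set w | exists2 n : nat, (0 < n)%N & A (Z n w)]).

Definition maximal_irreducibility_measure (psi : set X -> \bar R) :=
  irreducibility_measure psi /\
  forall phi : {sigma_finite_measure set X -> \bar R},
    irreducibility_measure phi -> phi `<< psi.

Definition harris_recurrent :=
  exists psi : {sigma_finite_measure set X -> \bar R},
    [/\ 0 < psi setT,
        maximal_irreducibility_measure psi
      & forall A, measurable A -> 0 < psi A -> forall x, A x ->
          for_chain_from x (fun dO Om Pr Z =>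
            Pr [set w | forall m : nat, exists2 n, (m <= n)%N & A (Z n w)]
            = 1)].

Definition positive_harris_recurrent :=
  harris_recurrent /\
  exists pi : probability X R,
    forall A, measurable A -> pi A = \int[pi]_x P x A.

End harris.

Section split_chain.
Context (d : measure_display) (X : measurableType d) (R : realType).
Variables (eps : R) (C : set X).

Definition residual_kernel (P : R.-pker X ~> X) (nu : probability X R)
    (x : X) (A : set X) : \bar R :=
  if (eps * \1_C x < 1)%R then
    (1 - eps * \1_C x)^-1%:E * (P x A - (eps * \1_C x)%:E * nu A)
  else \d_x A.

(* [{0, 1}] is [bool]; a set [E] of [X * bool] is the disjoint union of
   [A0 * {0}] and [A1 * {1}], and the value at [E] is the sum of the values at
   these two pieces. *)
Definition split_measure (mu : set X -> \bar R) (E : set (X * bool)) : \bar R :=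
  \int[mu]_(y in [set y | E (y, false)]) (1 - eps * \1_C y)%:E
  + eps%:E * mu ([set y | E (y, true)] `&` C).

Definition split_kernel (P : R.-pker X ~> X) (nu : probability X R)
    (z : X * bool) : set (X * bool) -> \bar R :=
  if z.2 then split_measure nu else split_measure (residual_kernel P nu z.1).

End split_chain.

Section times.
Context (R : realType).

(* Infimum of a set of integers, [+oo] for the empty set. *)
Definition inf_time (D : set nat) : \bar R := ereal_inf [set k%:R%:E | k in D].

(* [r(t)] for [t] an integer or [+oo]; a sequence is only given on the integers
   and [r(+oo) := 0], so that [E(r(t))] stands for [E(r(t) ; t < +oo)]. *)
Definition seq_at (r : nat -> R) (t : \bar R) : \bar R :=
  if t is s%:E then (r (Num.truncn s))%:E else 0.

Definition return_time (Om X : Type) (C : set X) (Y : nat -> Om -> X)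
    (w : Om) : \bar R :=
  inf_time [set k | (1 <= k)%N /\ C (Y k w)].

Definition regeneration_time (Om X : Type) (Z : nat -> Om -> X * bool)
    (w : Om) : \bar R :=
  inf_time [set k | (Z k w).2 = true].

End times.

(* [Pt x] is the law under which the process [Y] is started at [x]. *)
Definition W (dO : measure_display) (Om : measurableType dO) (X : Type)
    (R : realType) (Pt : X -> probability Om R) (Y : nat -> Om -> X)
    (C : set X) (r : nat -> R) (g : X -> R) (x : X) : \bar R :=
  \int[Pt x]_w \sum_(1 <= k <oo | k%:R%:E <= return_time R C Y w)
    (r k * g (Y k w))%:E.

(* Main.v *)
(* Let Q be the residual kernel, Phi f = (1 - eps 1_C) Q f and
   T f = 1_{C^c} Q f.  Killing the split chain when the coin shows 1 and averaging
   over the coin gives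
     E[f(X_n); d_0 = ... = d_{n-1} = 0] = (Phi^n f)(x),
     P(regeneration time = n) = (Phi^n (eps 1_C))(x),
   while W(y) = sum_i r(i+1) (Q T^i g)(y).  Since Phi = T + (1 - eps) 1_C Q,
   splitting at the last visit to C gives
     Phi^(n+1) g = T^(n+1) g + sum_{j <= n} Phi^j ((1 - eps) 1_C Q T^(n-j) g).
   Multiply by r(n+1) <= K r(j) r(n-j+1) and sum over n: the first term yields
   1_{C^c}(x) W(x), and in the second the sum over n-j is at most
   (1 - eps) (sup_C W) 1_C, leaving sum_j r(j) (Phi^j 1_C)(x). *)

Require Import Defs.
From HB Require Import structures.
From mathcomp Require Import all_boot all_order all_algebra.
From mathcomp Require Import all_classical all_reals all_analysis.
From mathcomp Require Import finmap measurable_realfun.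

Set Implicit Arguments.
Unset Strict Implicit.
Unset Printing Implicit Defensive.
Import Order.TTheory GRing.Theory Num.Theory.
Import numFieldNormedType.Exports.

Local Open Scope classical_set_scope.
Local Open Scope ring_scope.
Local Open Scope ereal_scope.

(** * Integrals against plain set functions *)

Section eq_set_fun_integral.
Import HBNNSimple.

(** Only the measurable level sets of simple functions enter the definition of the integral. Inside
    [split_measure] this lets a genuine measure replace the set function [residual_kernel]. *)
Lemma eq_set_fun_integral d (T : measurableType d) (R : realType)
    (m1 m2 : set T -> \bar R) (D : set T) (f : T -> \bar R) :
  (forall A, measurable A -> m1 A = m2 A) ->
  \int[m1]_(t in D) f t = \int[m2]_(t in D) f t.
Proof.
move=> m12; rewrite /integral.
suff s12 (h : {nnsfun T >-> R}) : sintegral m1 h = sintegral m2 h.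
  by congr (ereal_sup _ - ereal_sup _); apply: eq_imagel => h _; rewrite s12.
by apply: eq_fsbigr => r _; rewrite m12.
Qed.

End eq_set_fun_integral.

(** * Nonnegative measurable functions and the kernel operators acting on them *)

Definition nonneg_measurable d (T : measurableType d) (R : realType)
    (f : T -> \bar R) :=
  measurable_fun setT f /\ forall t, 0 <= f t.

Section nonneg_measurable.
Context d (T : measurableType d) (R : realType).
Implicit Types f g : T -> \bar R.

Lemma nonneg_measurable_cst (c : \bar R) :
  0 <= c -> nonneg_measurable (fun _ : T => c).
Proof. by move=> c0; split => //; exact: measurable_cst. Qed.

Lemma nonneg_measurable_indic (A : set T) :
  measurable A -> nonneg_measurable (fun t => (\1_A t : R)%:E).
Proof.
by move=> mA; split=> [|t]; [exact/measurable_EFinP|rewrite lee_fin].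
Qed.

Lemma nonneg_measurableD f g : nonneg_measurable f -> nonneg_measurable g ->
  nonneg_measurable (fun t => f t + g t).
Proof.
by move=> [mf f0] [mg g0]; split=> [|t]; [exact: emeasurable_funD|exact: adde_ge0].
Qed.

Lemma nonneg_measurableM f g : nonneg_measurable f -> nonneg_measurable g ->
  nonneg_measurable (fun t => f t * g t).
Proof.
by move=> [mf f0] [mg g0]; split=> [|t]; [exact: emeasurable_funM|exact: mule_ge0].
Qed.

Lemma nonneg_measurableZ (k : \bar R) f : 0 <= k -> nonneg_measurable f ->
  nonneg_measurable (fun t => k * f t).
Proof. by move=> k0; apply: nonneg_measurableM; exact: nonneg_measurable_cst. Qed.

Lemma nonneg_measurable_sum (f : nat -> T -> \bar R) n :
  (forall i, nonneg_measurable (f i)) ->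
  nonneg_measurable (fun t => \sum_(i < n) f i t).
Proof.
move=> nf; split=> [|t]; last by apply: sume_ge0 => i _; exact: (nf i).2.
by apply: emeasurable_sum => i; exact: (nf i).1.
Qed.

End nonneg_measurable.

(* The action [f |-> (s |-> \int[k s] f)] on nonnegative functions of a kernel
   [k], axiomatized so that closure under composition needs no construction of
   product or composed measures. *)
Record kernel_operator dT (T : measurableType dT) dS (S : measurableType dS)
    (R : realType) (A : (T -> \bar R) -> S -> \bar R) : Prop := KernelOperator {
  kop_nm : forall f, nonneg_measurable f -> nonneg_measurable (A f);
  kop_le : forall f g, nonneg_measurable f -> nonneg_measurable g ->
    (forall t, f t <= g t) -> forall s, A f s <= A g s;
  kopD : forall f g, nonneg_measurable f -> nonneg_measurable g ->
    forall s, A (fun t => f t + g t) s = A f s + A g s;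
  kopZ : forall k f, 0 <= k -> nonneg_measurable f ->
    forall s, A (fun t => k * f t) s = k * A f s;
  kop_cvg : forall (f_ : nat -> T -> \bar R) f,
    (forall n, nonneg_measurable (f_ n)) ->
    (forall t, nondecreasing_seq (f_ ^~ t)) ->
    (forall t, f_ n t @[n --> \oo] --> f t) ->
    forall s, A (f_ n) s @[n --> \oo] --> A f s }.

Section kernel_operator_theory.
Context dT (T : measurableType dT) dS (S : measurableType dS) (R : realType).
Import HBNNSimple.
Implicit Types A B : (T -> \bar R) -> S -> \bar R.

Lemma kop_sum A (f : nat -> T -> \bar R) n s :
  kernel_operator A -> (forall i, nonneg_measurable (f i)) ->
  A (fun t => \sum_(i < n) f i t) s = \sum_(i < n) A (f i) s.
Proof.
move=> kA nf; elim: n => [|n IH].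
  under eq_fun do rewrite big_ord0 -(mul0e 0).
  by rewrite (kopZ kA)// ?mul0e ?big_ord0//; exact: nonneg_measurable_cst.
under eq_fun do rewrite big_ord_recr/=.
by rewrite (kopD kA)//; [rewrite IH big_ord_recr|exact: nonneg_measurable_sum].
Qed.

(** Standard extension argument: linearity passes from indicators to simple functions, and [kop_cvg]
    to their increasing limits. The point [s] stays fixed, so agreement is needed at that point
    only. *)
Lemma kernel_operator_ext A B s :
  kernel_operator A -> kernel_operator B ->
  (forall E, measurable E ->
    A (fun t => (\1_E t)%:E) s = B (fun t => (\1_E t)%:E) s) ->
  forall f, nonneg_measurable f -> A f s = B f s.
Proof.
move=> kA kB AB f [mf f0].
pose f_ := nnsfun_approx measurableT mf.
pose F n t := (f_ n t)%:E.
have nF n : nonneg_measurable (F n).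
  by split=> [|t]; [exact/measurable_EFinP|rewrite lee_fin].
have F_nd t : nondecreasing_seq (F ^~ t).
  by move=> m n mn; rewrite lee_fin; exact/lefP/nd_nnsfun_approx.
have F_cvg t : F n t @[n --> \oo] --> f t by exact: cvg_nnsfun_approx.
have ABF n : A (F n) s = B (F n) s.
  (* The simple function is written as a sum over its list of values. The weight is set to 0 past
     the end of the list, so that [G i] is nonnegative for every natural [i], as [kop_sum] asks. *)
  pose l : seq R := finmap.enum_fset (fset_set (range (f_ n))).
  pose G i t := (if (i < size l)%N then (l`_i)%:E else 0) *
     (\1_(f_ n @^-1` [set l`_i]) t)%:E.
  have l0 i : 0 <= (if (i < size l)%N then (l`_i)%:E else 0) :> \bar R.
    case: ifPn => // il; rewrite lee_fin.
    have : l`_i \in fset_set (range (f_ n)) by exact: mem_nth.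
    by rewrite (in_fset_set (fimfunP (f_ n))) => /set_mem[t _ <-].
  have nI i : nonneg_measurable (fun t => (\1_(f_ n @^-1` [set l`_i]) t : R)%:E).
    exact: nonneg_measurable_indic.
  have FE : F n = fun t => \sum_(i < size l) G i t.
    apply/funext => t; rewrite /F fimfunE fsbig_finite//= (big_nth 0%R) big_mkord -sumEFin.
    apply: eq_bigr => i _.
    by rewrite /G ltn_ord EFinM.
  have nG i : nonneg_measurable (G i) by exact: nonneg_measurableZ.
  rewrite FE (kop_sum _ _ kA nG) (kop_sum _ _ kB nG).
  by apply: eq_bigr => i _; rewrite (kopZ kA)// (kopZ kB)// AB.
have /cvg_lim <- // : A (F n) s @[n --> \oo] --> A f s by exact: kop_cvg.
have /cvg_lim <- // : B (F n) s @[n --> \oo] --> B f s by exact: kop_cvg.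
by congr (lim (_ @ \oo)); exact/funext.
Qed.

End kernel_operator_theory.

(** * Examples and closure properties of kernel operators *)

Section kernel_operator_constructions.
Context (R : realType).

Lemma kernel_operator_integral dT (T : measurableType dT)
    dS (S : measurableType dS) (l : S -> {measure set T -> \bar R}) :
  (forall E, measurable E -> measurable_fun setT (l ^~ E)) ->
  kernel_operator (fun (f : T -> \bar R) s => \int[l s]_t f t).
Proof.
move=> ml; split.
- move=> f [mf f0]; split=> [|s]; last exact: integral_ge0.
  exact: measurable_fun_integral_kernel.
- by move=> f g [mf f0] [mg g0] fg s; apply: ge0_le_integral.
- by move=> f g [mf f0] [mg g0] s; rewrite ge0_integralD.
- by move=> k f k0 [mf f0] s; rewrite ge0_integralZl.
- move=> f_ f nf f_nd f_cvg s.
  have -> : f = fun t => limn (f_ ^~ t).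
    by apply/funext => t; apply/esym/cvg_lim => //; exact: f_cvg.
  apply: cvg_monotone_convergence => //.
  + by move=> n; exact: (nf n).1.
  + by move=> n t _; exact: (nf n).2.
Qed.

(** The output is constant on a dummy space [S], which brings expectations within reach of
    [kernel_operator_ext] and of composition. *)
Lemma kernel_operator_expectation dT (T : measurableType dT)
    dS (S : measurableType dS) (m : {measure set T -> \bar R}) :
  kernel_operator (fun (f : T -> \bar R) (_ : S) => \int[m]_t f t).
Proof. by apply: kernel_operator_integral => E mE; exact: measurable_cst. Qed.

Lemma kernel_operatorM dT (T : measurableType dT) (h : T -> R) :
  measurable_fun setT h -> (forall t, 0 <= h t)%R ->
  kernel_operator (fun (f : T -> \bar R) t => (h t)%:E * f t).
Proof.
move=> mh h0; split.
- move=> f nf; apply: nonneg_measurableM => //.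
  by split=> [|t]; [exact/measurable_EFinP|rewrite lee_fin].
- by move=> f g _ _ fg t; rewrite lee_wpmul2l// lee_fin.
- by move=> f g [_ f0] [_ g0] t; rewrite ge0_muleDr.
- by move=> k f k0 _ t; rewrite muleCA.
- by move=> f_ f _ _ f_cvg t; exact: cvgeZl.
Qed.

Lemma kernel_operator_precomp dT (T : measurableType dT)
    dS (S : measurableType dS) (V : S -> T) :
  measurable_fun setT V ->
  kernel_operator (fun (f : T -> \bar R) s => f (V s)).
Proof.
move=> mV; split=> //.
by move=> f [mf f0]; split=> [|s]; [exact: measurableT_comp|exact: f0].
Qed.

Lemma kernel_operator_comp dT (T : measurableType dT)
    dS (S : measurableType dS) dU (U : measurableType dU)
    (A : (T -> \bar R) -> S -> \bar R) (B : (S -> \bar R) -> U -> \bar R) :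
  kernel_operator A -> kernel_operator B ->
  kernel_operator (fun f => B (A f)).
Proof.
move=> kA kB; split.
- by move=> f nf; exact/(kop_nm kB)/(kop_nm kA).
- move=> f g nf ng fg; apply: (kop_le kB); try exact: (kop_nm kA).
  exact: (kop_le kA).
- move=> f g nf ng s; rewrite -(kopD kB); try exact: (kop_nm kA).
  by congr (B _ s); apply/funext => t; rewrite (kopD kA).
- move=> k f k0 nf s; rewrite -(kopZ kB)//; last exact: (kop_nm kA).
  by congr (B _ s); apply/funext => t; rewrite (kopZ kA).
- move=> f_ f nf f_nd f_cvg; apply: (kop_cvg kB).
  + by move=> n; exact: (kop_nm kA).
  + by move=> t m n mn; apply: (kop_le kA) => // u; exact: f_nd.
  + exact: (kop_cvg kA).
Qed.

Lemma kernel_operatorD dT (T : measurableType dT) dS (S : measurableType dS)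
    (A B : (T -> \bar R) -> S -> \bar R) :
  kernel_operator A -> kernel_operator B ->
  kernel_operator (fun f s => A f s + B f s).
Proof.
move=> kA kB.
have A0 f s : nonneg_measurable f -> 0 <= A f s by move=> /(kop_nm kA)[].
have B0 f s : nonneg_measurable f -> 0 <= B f s by move=> /(kop_nm kB)[].
split.
- by move=> f nf; apply: nonneg_measurableD; [exact: (kop_nm kA)|exact: (kop_nm kB)].
- by move=> f g nf ng fg s; rewrite leeD//; [exact: (kop_le kA)|exact: (kop_le kB)].
- by move=> f g nf ng s; rewrite (kopD kA)// (kopD kB)// addeACA.
- by move=> k f k0 nf s; rewrite (kopZ kA)// (kopZ kB)// ge0_muleDr// (A0, B0).
- move=> f_ f nf f_nd f_cvg s.
  (* Nothing is assumed of the limit [f], but it inherits measurability and nonnegativity from [f_].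
     Hence [A f s] and [B f s] are nonnegative and their sum is never of the form oo - oo. *)
  have nf' : nonneg_measurable f.
    split=> [|t]; first by apply: (emeasurable_fun_cvg f_) => [n|t _];
      [exact: (nf n).1|exact: f_cvg].
    have <- : limn (f_ ^~ t) = f t by apply/cvg_lim => //; exact: f_cvg.
    apply: lime_ge; first by apply/cvg_ex; exists (f t); exact: f_cvg.
    by apply: nearW => n; exact: (nf n).2.
  apply: cvgeD; [|exact: (kop_cvg kA)|exact: (kop_cvg kB)].
  by rewrite ge0_adde_def// inE ?A0 ?B0.
Qed.

Lemma kernel_operator_if dT (T : measurableType dT) dS (S : measurableType dS)
    (b : S -> bool) (A B : (T -> \bar R) -> S -> \bar R) :
  measurable_fun setT b -> kernel_operator A -> kernel_operator B ->
  kernel_operator (fun f s => if b s then A f s else B f s).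
Proof.
move=> mb kA kB; split.
- move=> f nf; split=> [|s]; last first.
    by case: (b s); [exact: (kop_nm kA nf).2|exact: (kop_nm kB nf).2].
  by apply: measurable_fun_ifT => //; [exact: (kop_nm kA nf).1|exact: (kop_nm kB nf).1].
- by move=> f g nf ng fg s; case: (b s); [exact: (kop_le kA)|exact: (kop_le kB)].
- by move=> f g nf ng s; case: (b s); [exact: (kopD kA)|exact: (kopD kB)].
- by move=> k f k0 nf s; case: (b s); [exact: (kopZ kA)|exact: (kopZ kB)].
- by move=> f_ f nf f_nd f_cvg s; case: (b s); [exact: (kop_cvg kA)|exact: (kop_cvg kB)].
Qed.

Lemma kernel_operator_iter dT (T : measurableType dT)
    (A : (T -> \bar R) -> T -> \bar R) n :
  kernel_operator A -> kernel_operator (iter n A).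
Proof.
move=> kA; elim: n => [|n IH]; last exact: (kernel_operator_comp IH kA).
exact: (@kernel_operator_precomp _ _ _ _ id).
Qed.

End kernel_operator_constructions.

(** * Markov chains killed on leaving a set *)

Lemma sigma_preimage_measurable dO (Om : measurableType dO) d
    (T : measurableType d) n (Z : 'I_n -> Om -> T) :
  (forall i, measurable_fun setT (Z i)) ->
  g_sigma_preimage Z `<=` measurable.
Proof.
move=> mZ; apply: smallest_sub; first exact: sigma_algebra_measurable.
apply: (big_ind (fun G => G `<=` measurable)) => [//|F G FM GM|i _].
  by rewrite subUset.
by move=> _ [E mE <-]; exact: mZ.
Qed.

Section stays_in.
Context (Om T : Type) (Z : nat -> Om -> T).

(** The window excludes time [n], so the event is decided strictly before [n]. It serves as the
    event that a hitting time is at least [n]: the return to [C] when [a] is 1 and [D] is the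
    complement of [C], the regeneration when [a] is 0 and [D] means coin 0. *)
Definition stays_in (D : set T) (a n : nat) : set Om :=
  [set w | forall i, (a <= i < n)%N -> D (Z i w)].

Lemma stays_inS D a n : (a <= n)%N ->
  stays_in D a n.+1 = stays_in D a n `&` Z n @^-1` D.
Proof.
move=> an; apply/seteqP; split=> [w h|w [h Dw] i /andP[ai]].
  split=> [i /andP[ai /ltnW ni]|]; first by apply: h; rewrite ai.
  by apply: h; rewrite an /=.
by rewrite ltnS leq_eqVlt => /predU1P[->//|ni]; apply: h; rewrite ai.
Qed.

Lemma stays_in_ge D a n : (n <= a)%N -> stays_in D a n = setT.
Proof.
move=> na; apply/seteqP; split=> // w _ i /andP[ai /(leq_trans)/(_ na)].
by rewrite ltnNge ai.
Qed.

End stays_in.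

Section killed_markov_chain.
Context dO (Om : measurableType dO) d (T : measurableType d) (R : realType).
Variables (Pr : probability Om R) (mu : set T -> \bar R).
Variables (K : T -> set T -> \bar R) (Z : nat -> Om -> T).
Hypothesis hZ : markov_chain Pr mu K Z.

Let mZ n : measurable_fun setT (Z n).
Proof. by case: hZ. Qed.

(** Since [mu] is only a set function, [M f s] stands in for the integral of [f] against it. Both
    sides are kernel operators in [f], so indicators suffice. *)
Lemma markov_chain_initial dS (S : measurableType dS)
    (M : (T -> \bar R) -> S -> \bar R) s f :
  kernel_operator M ->
  (forall E, measurable E -> M (fun t => (\1_E t)%:E) s = mu E) ->
  nonneg_measurable f -> \int[Pr]_w f (Z 0%N w) = M f s.
Proof.
move=> kM hM nf.
have kE : kernel_operator (fun (h : T -> \bar R) (_ : S) =>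
    \int[Pr]_w h (Z 0%N w)).
  apply: kernel_operator_comp (kernel_operator_expectation _ Pr).
  exact: kernel_operator_precomp.
apply: (kernel_operator_ext (s := s) kE kM) => //.
move=> E mE; rewrite hM//; case: hZ => _ /(_ _ mE) <- _.
rewrite (integral_indic Pr measurableT (A := Z 0%N @^-1` E)) ?setIT//.
by rewrite -[X in measurable X]setTI; exact: mZ.
Qed.

Variable op : (T -> \bar R) -> T -> \bar R.
Hypothesis kop : kernel_operator op.
Hypothesis opK : forall E z, measurable E -> op (fun t => (\1_E t)%:E) z = K z E.

(** For fixed [B] both sides are kernel operators in [f], and on indicators the identity is the
    Markov clause of [markov_chain]. *)
Lemma markov_chain_step n B f :
  g_sigma_preimage (fun i : 'I_n.+1 => Z i) B -> nonneg_measurable f ->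
  \int[Pr]_w ((\1_B w)%:E * f (Z n.+1 w)) =
  \int[Pr]_w ((\1_B w)%:E * op f (Z n w)).
Proof.
move=> sB.
have mB : measurable B by apply: sigma_preimage_measurable sB => i; exact: mZ.
have kE V : measurable_fun setT V ->
    kernel_operator (fun (h : T -> \bar R) (_ : T) =>
      \int[Pr]_w ((\1_B w)%:E * h (V w))).
  move=> mV.
  have kB : kernel_operator (fun (h : Om -> \bar R) w => (\1_B w)%:E * h w).
    by apply: kernel_operatorM => //; exact: measurable_indic.
  have kVB := kernel_operator_comp (kernel_operator_precomp R mV) kB.
  exact: kernel_operator_comp kVB (kernel_operator_expectation _ Pr).
move=> nf.
(* Both operators are constant in their last argument, so any point will do. *)
apply: (kernel_operator_ext (s := point) (kE _ (mZ n.+1))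
  (kernel_operator_comp kop (kE _ (mZ n)))) => // E mE.
have mZE : measurable (Z n.+1 @^-1` E).
  by rewrite -[X in measurable X]setTI; exact: mZ.
transitivity (Pr (B `&` Z n.+1 @^-1` E)).
  rewrite -[LHS]/(\int[Pr]_w ((\1_B w)%:E * (\1_(Z n.+1 @^-1` E) w)%:E)).
  under eq_integral do rewrite -EFinM -[(_ * _)%R]/((\1_B \* \1_(Z n.+1 @^-1` E)) _)%R.
  by rewrite -indicI integral_indic ?setIT//; exact: measurableI.
case: hZ => _ _ ->//; rewrite integral_mkcond epatch_indic.
by apply: eq_integral => w _; rewrite /= muleC opK.
Qed.

Lemma sigma_preimage_stays_in D a n m : measurable D -> (m <= n)%N ->
  g_sigma_preimage (fun i : 'I_n => Z i) (stays_in Z D a m).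
Proof.
move=> mD; elim: m => [|m IH] mn.
  rewrite stays_in_ge//.
  exact: (@measurableT _ (g_sigma_algebraType _)).
have [am|ma] := leqP a m; last first.
  by rewrite stays_in_ge//; exact: (@measurableT _ (g_sigma_algebraType _)).
rewrite stays_inS//.
apply: (@measurableI _ (g_sigma_algebraType _)); first exact: (IH (ltnW mn)).
apply: sub_sigma_algebra.
rewrite (bigD1 (Ordinal mn))//=; left; exists D => //; exact: setTI.
Qed.

Lemma stays_in_measurable D a n : measurable D -> measurable (stays_in Z D a n).
Proof.
move=> mD; apply: (sigma_preimage_measurable (Z := fun i : 'I_n => Z i)) => //.
exact: sigma_preimage_stays_in.
Qed.

Lemma nonneg_measurable_killed D a n (f : T -> \bar R) :
  measurable D -> nonneg_measurable f ->
  nonneg_measurable (fun w => (\1_(stays_in Z D a n) w)%:E * f (Z n w)).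
Proof.
move=> mD nf; apply: nonneg_measurableM.
  exact/nonneg_measurable_indic/stays_in_measurable.
by case: nf => mf f0; split=> [|w] //; exact: measurableT_comp.
Qed.

(** Induction removes the last step: the Markov property turns [f] at time [a + n + 1] into [op f]
    at time [a + n], and the constraint at time [a + n] is absorbed as the factor 1_D. The function
    therefore varies in the induction. *)
Lemma killed_markov_chain D a n f : measurable D -> nonneg_measurable f ->
  \int[Pr]_w ((\1_(stays_in Z D a (a + n)) w)%:E * f (Z (a + n)%N w)) =
  \int[Pr]_w iter n (fun h t => (\1_D t)%:E * op h t) f (Z a w).
Proof.
move=> mD; elim: n f => [|n IH] f nf.
  by rewrite addn0; apply: eq_integral => w _; rewrite stays_in_ge// indicT mul1e.
rewrite iterSr -IH; last first.
  by apply: nonneg_measurableM; [exact: nonneg_measurable_indic|exact: (kop_nm kop)].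
rewrite addnS markov_chain_step//; last exact: sigma_preimage_stays_in.
apply: eq_integral => w _; rewrite stays_inS ?leq_addr// indicI EFinM muleA.
by [].
Qed.

End killed_markov_chain.

(** * The residual kernel as a measurable family of measures *)

Section residual_kernel_theory.
Context d (X : measurableType d) (R : realType).
Variables (P : R.-pker X ~> X) (eps : R) (C : set X) (nu : probability X R).
Hypothesis eps_le1 : (eps <= 1)%R.
Hypothesis mC : measurable C.
Hypothesis hmin : forall (x : X) (A : set X), C x -> measurable A ->
  eps%:E * nu A <= P x A.

Lemma residual_kernelE x A : residual_kernel eps C P nu x A =
  if x \in C then
    if (eps < 1)%R then (1 - eps)^-1%:E * (P x A - eps%:E * nu A) else \d_x A
  else P x A.
Proof.
rewrite /residual_kernel indicE; case: (x \in C); first by rewrite mulr1.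
by rewrite mulr0 ltr01 subr0 invr1 mul1e mul0e sube0.
Qed.

(** Off [C] the measure is [P x], and on [C] with [eps] equal to 1 it is a Dirac mass. Otherwise P -
    eps nu is countably additive as a combination of charges, and the minorization makes it
    nonnegative. *)
Lemma residual_kernel_is_measure x : exists m : {measure set X -> \bar R},
  forall A, measurable A -> m A = residual_kernel eps C P nu x A.
Proof.
have [xC|xC] := boolP (x \in C); last first.
  by exists (P x) => A _; rewrite residual_kernelE (negbTE xC).
have [eps1|eps1] := ltP eps 1%R; last first.
  by exists (dirac x) => A _; rewrite residual_kernelE xC ltNge eps1.
pose Px_charge := isCharge.Build _ _ _ (P x) (measure0 (P x))
  (@kernel_finite_transition _ _ _ _ R P x) measure_semi_sigma_additive.
pose Pch : {charge set X -> \bar R} := HB.pack (Measure.sort (P x)) Px_charge.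
pose nuch : {charge set X -> \bar R} := charge_of_finite_measure nu.
pose ch : {charge set X -> \bar R} :=
  cscale (1 - eps)^-1 (cadd Pch (cscale (- eps) nuch)).
have chE A : ch A = residual_kernel eps C P nu x A by
  rewrite residual_kernelE xC eps1 -mulNe.
(* [residual_kernel] is constrained only on measurable sets, whereas a measure
   must be nonnegative on every set. *)
pose m A := if `[< measurable A >] then ch A else 0.
have mE A : measurable A -> m A = ch A by move=> mA; rewrite /m asboolT.
have m0 : m set0 = 0 by rewrite mE ?charge0.
have m_ge0 A : 0 <= m A.
  rewrite /m; case: asboolP => // mA; rewrite chE residual_kernelE xC eps1.
  rewrite mule_ge0// ?lee_fin ?invr_ge0 ?subr_ge0//.
  rewrite sube_ge0; first by apply: hmin => //; exact: set_mem.
  by rewrite fin_numM// fin_num_measure.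
have m_add : semi_sigma_additive m.
  move=> F mF tF mUF; rewrite mE//.
  under eq_fun do under eq_bigr do rewrite mE//.
  exact: charge_semi_sigma_additive.
pose M := isMeasure.Build _ _ _ m m0 m_ge0 m_add.
pose m' : {measure set X -> \bar R} := HB.pack m M.
by exists m' => A mA; rewrite -chE -mE.
Qed.

Lemma measurable_residual_kernel A : measurable A ->
  measurable_fun setT (residual_kernel eps C P nu ^~ A).
Proof.
move=> mA; under eq_fun do rewrite residual_kernelE.
apply: measurable_fun_ifT.
- apply: (measurable_fun_bool true); rewrite setTI.
  by rewrite [X in measurable X](_ : _ = C)//; apply/seteqP;
    split=> x /=; [exact: set_mem|exact: mem_set].
- case: ltP => _; last first.
    rewrite (_ : (fun t => \d_t A) = fun t => (\1_A t : R)%:E)//.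
    exact/measurable_EFinP/measurable_indic.
  apply: measurable_funeM; apply: emeasurable_funB => //.
  exact: measurable_kernel.
- exact: measurable_kernel.
Qed.

End residual_kernel_theory.

(** * The split chain up to its regeneration *)

Lemma measurable_bool_snd d (X : measurableType d) (b : bool -> bool) :
  measurable [set z : X * bool | b z.2].
Proof.
rewrite -[[set z : X * bool | _]]/(snd @^-1` [set u | b u]).
by rewrite -[X in measurable X]setTI; exact: measurable_snd.

Qed.

(* Integrates out the coin of level [y]: the integral of [f] against
   [split_measure mu] is that of [split_average f] against [mu]. *)
Definition split_average (R : realType) (X : Type) (eps : R) (C : set X)
    (f : X * bool -> \bar R) (y : X) : \bar R :=
  (1 - eps * \1_C y)%:E * f (y, false) + (eps * \1_C y)%:E * f (y, true).

Section split_chain_theory.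
Context d (X : measurableType d) (R : realType).
Variables (P : R.-pker X ~> X) (eps : R) (C : set X) (nu : probability X R).
Hypotheses (eps_gt0 : (0 < eps)%R) (eps_le1 : (eps <= 1)%R).
Hypothesis mC : measurable C.

Lemma measurable_split_weight : measurable_fun setT (fun y => 1 - eps * \1_C y)%R.
Proof.
by apply: measurable_funB => //; exact: measurable_funM.
Qed.

Lemma split_weight_ge0 y : (0 <= 1 - eps * \1_C y)%R.
Proof.
by rewrite subr_ge0 indicE; case: (_ \in _); rewrite ?mulr1 ?mulr0.
Qed.

Lemma kernel_operator_split_weight0 :
  kernel_operator (fun (f : X * bool -> \bar R) y =>
    (1 - eps * \1_C y)%:E * f (y, false)).
Proof.
apply: kernel_operator_comp (kernel_operatorM measurable_split_weight split_weight_ge0).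
exact/kernel_operator_precomp/pair2_measurable.
Qed.

Lemma kernel_operator_split_weight1 :
  kernel_operator (fun (f : X * bool -> \bar R) y =>
    (eps * \1_C y)%:E * f (y, true)).
Proof.
have mh : measurable_fun setT (fun y : X => eps * \1_C y : R)%R.
  exact: measurable_funM.
have h0 y : (0 <= eps * \1_C y)%R by rewrite mulr_ge0// ltW.
apply: kernel_operator_comp (kernel_operatorM mh h0).
exact/kernel_operator_precomp/pair2_measurable.
Qed.

Lemma kernel_operator_split_average :
  kernel_operator (fun f : X * bool -> \bar R => split_average eps C f).
Proof.
exact: kernel_operatorD kernel_operator_split_weight0 kernel_operator_split_weight1.
Qed.

Lemma split_measureE (m : {measure set X -> \bar R}) (E : set (X * bool)) :
  measurable E ->
  split_measure eps C m E = \int[m]_y split_average eps C (fun z => (\1_E z)%:E) y.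
Proof.
move=> mE.
have mEb b : measurable [set y | E (y, b)].
  by rewrite -[X in measurable X]setTI; exact: pair2_measurable.
have mEC : measurable ([set y | E (y, true)] `&` C) by exact: measurableI.
have nE := nonneg_measurable_indic R mE.
have [m0 p0] := kop_nm kernel_operator_split_weight0 nE.
have [m1 p1] := kop_nm kernel_operator_split_weight1 nE.
rewrite /split_average ge0_integralD//.
congr (_ + _).
  by rewrite integral_mkcond epatch_indic.
under eq_integral => y _.
  rewrite (_ : _ * _ = eps%:E * (\1_([set y | E (y, true)] `&` C) y)%:E); last first.
    by rewrite indicI -!EFinM /= -mulrA [(\1_C y * _)%R]mulrC.
  over.
rewrite ge0_integralZl//; last by rewrite lee_fin ltW.
- by rewrite integral_indic// setIT.
- exact/measurable_EFinP/measurable_indic.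
Qed.

Variable Q : X -> {measure set X -> \bar R}.
Hypothesis QE : forall x A, measurable A -> Q x A = residual_kernel eps C P nu x A.
Hypothesis mQ : forall A, measurable A -> measurable_fun setT (Q ^~ A).

Lemma split_kernel_residualE x (E : set (X * bool)) : measurable E ->
  split_measure eps C (residual_kernel eps C P nu x) E = split_measure eps C (Q x) E.
Proof.
move=> mE.
have mE1 : measurable [set y | E (y, true)].
  by rewrite -[X in measurable X]setTI; exact: pair2_measurable.
rewrite /split_measure QE; last exact: measurableI.
by congr (_ + _); apply: eq_set_fun_integral => A mA; rewrite QE.
Qed.

(** The action of [split_kernel] on functions, with the measures [Q] in place of the residual set
    functions. *)
Definition split_operator (f : X * bool -> \bar R) (z : X * bool) : \bar R :=
  if z.2 then \int[nu]_y split_average eps C f y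
  else \int[Q z.1]_y split_average eps C f y.

Lemma kernel_operator_split_operator : kernel_operator split_operator.
Proof.
have kQ := kernel_operator_comp kernel_operator_split_average
  (kernel_operator_integral mQ).
apply: kernel_operator_if => //.
- exact: kernel_operator_comp kernel_operator_split_average
    (kernel_operator_expectation _ _).
- exact: kernel_operator_comp kQ (kernel_operator_precomp R measurable_fst).
Qed.

Lemma split_operator_indic (E : set (X * bool)) z : measurable E ->
  split_operator (fun t => (\1_E t)%:E) z = split_kernel eps C P nu z E.
Proof.
move=> mE; rewrite /split_operator /split_kernel.
by case: z.2; rewrite ?split_kernel_residualE// split_measureE.
Qed.

(** Averaging over coins reduces functions on [X * bool] to functions on [X]. The coins before time
    [n] are forced to be 0, while the coin at time [n] is free and is averaged inside
    [split_average eps C f]. *)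
Lemma killed_split_chain dZ (Om : measurableType dZ) (Pr : probability Om R)
    (Z : nat -> Om -> X * bool) x n (f : X * bool -> \bar R) :
  markov_chain Pr (split_measure eps C \d_x) (split_kernel eps C P nu) Z ->
  nonneg_measurable f ->
  \int[Pr]_w ((\1_(stays_in Z [set z | ~~ z.2] 0 n) w)%:E * f (Z n w)) =
  iter n (fun h y => (1 - eps * \1_C y)%:E * \int[Q y]_u h u)
    (split_average eps C f) x.
Proof.
move=> hZ nf.
have mD := @measurable_bool_snd _ X negb.
have kS := kernel_operator_split_operator.
rewrite (killed_markov_chain hZ kS split_operator_indic 0 n mD nf).
have kD : kernel_operator (fun (h : X * bool -> \bar R) t =>
    (\1_[set z | ~~ z.2] t)%:E * h t) by exact: kernel_operatorM.
have nF := kop_nm (kernel_operator_iter n (kernel_operator_comp kS kD)) nf.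
have kA := kernel_operator_split_average.
rewrite (markov_chain_initial (s := x) hZ kA _ nF); last first.
  move=> E mE; rewrite split_measureE// integral_dirac ?diracT ?mul1e//.
  exact: (kop_nm kA (nonneg_measurable_indic R mE)).1.
(* What remains is an intertwining of operators: averaging after one killed step keeps only the
   coin-0 branch, of weight 1 - eps 1_C, followed by [Q] applied to the average. *)
elim: n x {hZ nF} => [//|n IH] x /=.
rewrite -[RHS]/((1 - eps * \1_C x)%:E * _).
have i0 : \1_[set z : X * bool | ~~ z.2] (x, false) = 1%R :> R.
  by rewrite indicE mem_set.
have i1 : \1_[set z : X * bool | ~~ z.2] (x, true) = 0%R :> R.
  by rewrite indicE memNset.
rewrite /split_average /split_operator /= i0 i1.
rewrite mul1e mul0e mule0 adde0; congr (_ * _).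
by apply: eq_integral => y _; rewrite -/(split_average eps C _ y) IH.
Qed.

End split_chain_theory.

(** * Weighted series under the integral, and triangular double sums *)

Lemma integral_weighted_nneseries d (T : measurableType d) (R : realType)
    (m : {measure set T -> \bar R}) (c : nat -> R) (F : nat -> T -> \bar R) :
  (forall k, (0 <= c k)%R) -> (forall k, nonneg_measurable (F k)) ->
  \int[m]_t (\sum_(k <oo) (c k)%:E * F k t) =
  \sum_(k <oo) (c k)%:E * \int[m]_t F k t.
Proof.
move=> c0 nF.
have ncF k : nonneg_measurable (fun t => (c k)%:E * F k t).
  by apply: nonneg_measurableZ => //; rewrite lee_fin.
rewrite integral_nneseries//; last 2 first.
- by move=> k; exact: (ncF k).1.
- by move=> k t _; exact: (ncF k).2.
apply: eq_eseriesr => k _; have [mF F0] := nF k.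
by rewrite ge0_integralZl// lee_fin.
Qed.

(** With i = n - j the left side runs over the triangle j + i < N, which lies in the rectangle. The
    induction takes off the terms with j = 0 and shifts [a], keeping [M] fixed while [N]
    decreases. *)
Lemma lee_sum_triangle (R : realDomainType) (a : nat -> nat -> \bar R) N M :
  (forall j i, 0 <= a j i) -> (N <= M)%N ->
  \sum_(n < N) \sum_(j < n.+1) a j (n - j)%N <= \sum_(j < N) \sum_(i < M) a j i.
Proof.
elim: N a => [|N IH] a a0 NM; first by rewrite !big_ord0.
under eq_bigr do rewrite big_ord_recl subn0.
rewrite big_split/= [leRHS]big_ord_recl; apply: leeD.
  rewrite (big_ord_widen _ (fun n => a 0%N n) NM).
  rewrite [leRHS](bigID (fun i : 'I_M => (i < N.+1)%N))/=.
  by rewrite leeDl// sume_ge0.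
rewrite big_ord_recl big_ord0 add0e.
by apply: (IH (fun j => a j.+1)) => //; exact: ltnW.
Qed.

(** * The residual chain and the decomposition at the last visit to [C] *)

Section residual_chain.
Context d (X : measurableType d) (R : realType).
Variables (P : R.-pker X ~> X) (eps : R) (C : set X) (nu : probability X R).
Hypotheses (eps_gt0 : (0 < eps)%R) (eps_le1 : (eps <= 1)%R).
Hypothesis mC : measurable C.
Variable Q : X -> {measure set X -> \bar R}.
Hypothesis QE : forall x A, measurable A -> Q x A = residual_kernel eps C P nu x A.
Hypothesis mQ : forall A, measurable A -> measurable_fun setT (Q ^~ A).

(** The operator T of the overview; [killed_by_split] is Phi. Both weights are taken at the starting
    point, before the step by [Q]. *)
Definition killed_on_C (h : X -> \bar R) (y : X) : \bar R :=
  (\1_(~` C) y)%:E * \int[Q y]_u h u.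

Definition killed_by_split (h : X -> \bar R) (y : X) : \bar R :=
  (1 - eps * \1_C y)%:E * \int[Q y]_u h u.

Let kQ := kernel_operator_integral mQ.

Lemma kernel_operator_killed_on_C : kernel_operator killed_on_C.
Proof.
have kC : kernel_operator (fun (h : X -> \bar R) y => (\1_(~` C) y)%:E * h y).
  by apply: kernel_operatorM => //; exact/measurable_indic/measurableC.
exact: kernel_operator_comp kQ kC.
Qed.

Lemma kernel_operator_killed_by_split : kernel_operator killed_by_split.
Proof.
have kC := kernel_operatorM (measurable_split_weight eps mC)
  (split_weight_ge0 C eps_le1).
exact: kernel_operator_comp kQ kC.
Qed.

Let kT := kernel_operator_killed_on_C.
Let kPhi := kernel_operator_killed_by_split.

(** The return time ignores time 0, so the first step is an unrestricted step by [Q x] and only the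
    next [n] steps are killed. *)
Lemma killed_residual_chain dY (Om : measurableType dY) (Pr : probability Om R)
    (Y : nat -> Om -> X) x n (f : X -> \bar R) :
  markov_chain Pr \d_x (residual_kernel eps C P nu) Y ->
  nonneg_measurable f ->
  \int[Pr]_w ((\1_(stays_in Y (~` C) 1 n.+1) w)%:E * f (Y n.+1 w)) =
  \int[Q x]_y iter n killed_on_C f y.
Proof.
move=> hY nf.
have QK E z : measurable E ->
    \int[Q z]_t (\1_E t)%:E = residual_kernel eps C P nu z E.
  by move=> mE; rewrite integral_indic// setIT QE.
have := killed_markov_chain hY kQ QK 1 n (measurableC mC) nf.
rewrite add1n => ->; rewrite -/killed_on_C.
have nF := kop_nm (kernel_operator_iter n kT) nf.
have sT : g_sigma_preimage (fun i : 'I_1 => Y i) setT.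
  exact: (@measurableT _ (g_sigma_algebraType _)).
have oneE (F : Om -> \bar R) :
    \int[Pr]_w ((\1_setT w)%:E * F w) = \int[Pr]_w F w.
  by apply: eq_integral => w _; rewrite indicT mul1e.
(* The step from time 0 to time 1 is the Markov property with the sure event. *)
rewrite -oneE (markov_chain_step hY kQ QK sT nF) oneE.
have kid := @kernel_operator_precomp R _ X _ X id (@measurable_id _ _ _).
rewrite (markov_chain_initial (s := x) hY kid _ (kop_nm kQ nF))//.
Qed.

(** A last visit to [C] that happens [i + 1] steps before [f] is evaluated: the coin shows 0 there,
    and the next [i] states avoid [C]. *)
Definition exit_at_C (f : X -> \bar R) (i : nat) (y : X) : \bar R :=
  (1 - eps)%:E * ((\1_C y)%:E * \int[Q y]_u iter i killed_on_C f u).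

Let nE f i : nonneg_measurable f -> nonneg_measurable (exit_at_C f i).
Proof.
move=> nf; apply: nonneg_measurableZ; first by rewrite lee_fin subr_ge0.
apply: nonneg_measurableM; first exact: nonneg_measurable_indic.
exact/(kop_nm kQ)/(kop_nm (kernel_operator_iter i kT)).
Qed.

Lemma killed_by_splitE (h : X -> \bar R) y :
  killed_by_split h y =
  killed_on_C h y + (1 - eps)%:E * ((\1_C y)%:E * \int[Q y]_u h u).
Proof.
rewrite /killed_by_split /killed_on_C !indicE in_setC.
by case: (y \in C); rewrite ?mulr1 ?mulr0 ?subr0 !(mul1e, mul0e, mule0, add0e, adde0).
Qed.

(* Decomposition according to the last visit to [C] before time [n.+1]. *)
Lemma iter_killed_by_split (f : X -> \bar R) n y : nonneg_measurable f ->
  iter n.+1 killed_by_split f y = iter n.+1 killed_on_C f y +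
    \sum_(j < n.+1) iter j killed_by_split (exit_at_C f (n - j)) y.
Proof.
move=> nf; elim: n y => [|n IH] y.
  by rewrite big_ord_recl big_ord0 adde0 /= killed_by_splitE.
have nT := kop_nm (kernel_operator_iter n.+1 kT) nf.
have nPhi j i : nonneg_measurable (iter j killed_by_split (exit_at_C f i)).
  exact/(kop_nm (kernel_operator_iter j kPhi))/nE.
rewrite iterS (funext IH) (kopD kPhi)//; last first.
  by apply: (nonneg_measurable_sum (f := fun j => iter j _ (exit_at_C f (n - j)))).
(* Phi applied to T^(n+1) f gives T^(n+2) f and the new term j = 0; Phi applied to the old sum moves
   each j to j + 1. *)
rewrite killed_by_splitE -addeA; congr (_ + _).
rewrite (kop_sum (f := fun j => iter j _ (exit_at_C f (n - j))) _ _ kPhi)//.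
by rewrite [RHS]big_ord_recl subn0.
Qed.

(** A version with finite sums, so that rearranging raises no question of convergence. The bounds
    [w] and [M] stand for W(x) and sup_C W. *)
Lemma split_series_le (r : nat -> R) (K : R) (f : X -> \bar R) (w M : \bar R) x N :
  (forall n, (0 <= r n)%R) -> (0 <= K)%R ->
  (forall n m, (r (n + m)%N <= K * r n * r m)%R) ->
  nonneg_measurable f -> 0 <= w -> 0 <= M ->
  (forall n, \sum_(i < n) (r i.+1)%:E * \int[Q x]_u iter i killed_on_C f u <= w) ->
  (forall n y, C y ->
    \sum_(i < n) (r i.+1)%:E * \int[Q y]_u iter i killed_on_C f u <= M) ->
  \sum_(n < N) (r n)%:E * iter n killed_by_split f x <=
  (r 0%N)%:E * f x + (\1_(~` C) x)%:E * w +
  ((1 - eps) * K)%:E * M *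
    \sum_(n < N) (r n)%:E * iter n killed_by_split (fun y => (\1_C y)%:E) x.
Proof.
move=> r0 K0 rK nf w0 M0 ler_w ler_M.
have e0 : (0 <= 1 - eps)%R by rewrite subr_ge0.
have kPhij j := kernel_operator_iter j kPhi.
have nC : nonneg_measurable (fun y => (\1_C y : R)%:E).
  exact: nonneg_measurable_indic.
have tail_ge0 N' : 0 <= ((1 - eps) * K)%:E * M *
    \sum_(n < N') (r n)%:E * iter n killed_by_split (fun y => (\1_C y)%:E) x.
  rewrite mule_ge0//; first by rewrite mule_ge0// lee_fin mulr_ge0.
  by apply: sume_ge0 => j _; rewrite mule_ge0 ?lee_fin//; exact: (kop_nm (kPhij j) nC).2.
case: N => [|N].
  rewrite big_ord0; apply: adde_ge0 => //; apply: adde_ge0; rewrite mule_ge0 ?lee_fin//.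
  exact: nf.2.
rewrite big_ord_recl/= -addeA leeD2l//.
have nH j i : nonneg_measurable (iter j killed_by_split (exit_at_C f i)).
  exact/(kop_nm (kPhij j))/nE.
have nT i := kop_nm (kernel_operator_iter i kT) nf.
have last_visit n : (r n.+1)%:E * iter n.+1 killed_by_split f x =
    (r n.+1)%:E * iter n.+1 killed_on_C f x + \sum_(j < n.+1)
      (r n.+1)%:E * iter j killed_by_split (exit_at_C f (n - j)) x.
  rewrite iter_killed_by_split// ge0_muleDr; last 2 first.
  - exact: (nT n.+1).2.
  - by apply: sume_ge0 => j _; exact: (nH _ _).2.
  by rewrite ge0_sume_distrr// => j _; exact: (nH _ _).2.
under eq_bigr => i _.
  rewrite /bump leq0n add1n -[_ (iter i _ _) x]/(iter i.+1 killed_by_split f x).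
  rewrite last_visit.
  over.
rewrite big_split/=; apply: leeD.
  (* The outermost factor of T^(n+1) is the indicator at [x]; once it is factored out, a partial sum
     bounded by [w] is left. *)
  have pull_indic n : (r n.+1)%:E * iter n.+1 killed_on_C f x =
      (\1_(~` C) x)%:E * ((r n.+1)%:E * \int[Q x]_u iter n killed_on_C f u).
    exact: muleCA.
  under eq_bigr do rewrite pull_indic.
  rewrite -ge0_sume_distrr; last first.
    move=> i _; rewrite mule_ge0 ?lee_fin//.
    exact: (kop_nm kQ (nT i)).2.
  by rewrite lee_wpmul2l ?lee_fin//; exact: ler_w.
(* Since n + 1 = j + (n - j + 1), the bound on [r] separates j from i = n - j, and the triangle of
   pairs can then be enlarged to a square. *)
pose a j i := (K * r j)%:E * ((r i.+1)%:E * iter j killed_by_split (exit_at_C f i) x).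
have a0 j i : 0 <= a j i.
  by rewrite !mule_ge0// ?lee_fin ?mulr_ge0//; exact: (nH _ _).2.
apply: (@le_trans _ _ (\sum_(n < N) \sum_(j < n.+1) a j (n - j)%N)).
  apply: lee_sum => n _; apply: lee_sum => j _.
  rewrite /a muleA -EFinM lee_wpmul2r ?lee_fin//; first exact: (nH _ _).2.
  by rewrite (le_trans _ (rK _ _))// addnS subnKC// -ltnS.
apply: (le_trans (lee_sum_triangle a0 (leqnn N))).
(* For fixed j the sum over i goes inside Phi^j by linearity. There it is (1 - eps) 1_C times a
   partial sum that is at most [M] on [C], and Phi^j is monotone. *)
apply: (@le_trans _ _ (\sum_(j < N) (K * r j)%:E * ((1 - eps)%:E * M *
    iter j killed_by_split (fun y => (\1_C y)%:E) x))).
  apply: lee_sum => j _; rewrite /a -ge0_sume_distrr; last first.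
    by move=> i _; rewrite mule_ge0 ?lee_fin//; exact: (nH _ _).2.
  rewrite lee_wpmul2l ?lee_fin ?mulr_ge0//.
  have nrE i : nonneg_measurable (fun y => (r i.+1)%:E * exit_at_C f i y).
    by apply: nonneg_measurableZ; [rewrite lee_fin|exact: nE].
  have push_weight i : (r i.+1)%:E * iter j killed_by_split (exit_at_C f i) x =
      iter j killed_by_split (fun y => (r i.+1)%:E * exit_at_C f i y) x.
    by rewrite (kopZ (kPhij j)) ?lee_fin//; exact: nE.
  under eq_bigr do rewrite push_weight.
  rewrite -(kop_sum (f := fun i y => (r i.+1)%:E * exit_at_C f i y) _ _ (kPhij j))//.
  have eM0 : 0 <= (1 - eps)%:E * M by rewrite mule_ge0// lee_fin.
  rewrite -(kopZ (kPhij j))//; apply: (kop_le (kPhij j)).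
  - exact: (nonneg_measurable_sum
      (f := fun i y => (r i.+1)%:E * exit_at_C f i y)).
  - exact: nonneg_measurableZ.
  move=> y; rewrite /exit_at_C.
  under eq_bigr do rewrite muleCA [X in _ * X]muleCA.
  rewrite -ge0_sume_distrr; last first.
    move=> i _; rewrite !mule_ge0 ?lee_fin//.
    exact: (kop_nm kQ (nT i)).2.
  rewrite -muleA lee_wpmul2l ?lee_fin//.
  have [Cy|nCy] := pselect (C y).
    have -> : (\1_C y)%:E = 1 :> \bar R by rewrite indicE mem_set.
    by rewrite mule1; under eq_bigr do rewrite mul1e; exact: ler_M.
  have -> : (\1_C y)%:E = 0 :> \bar R by rewrite indicE memNset.
  by rewrite mule0 big1// => i _; rewrite mul0e.
rewrite ge0_sume_distrr; last first.
  move=> j _; rewrite mule_ge0 ?lee_fin//; exact: (kop_nm (kPhij j) nC).2.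
have C_ge0 j : 0 <= iter j killed_by_split (fun y => (\1_C y)%:E) x.
  exact: (kop_nm (kPhij j) nC).2.
(* The right-hand sum has one more index, j = N, whose nonnegative term is dropped. *)
rewrite big_ord_recr/= -[leLHS]adde0 leeD//; last first.
  by rewrite !mule_ge0 ?lee_fin ?mulr_ge0.
apply: lee_sum => j _; rewrite muleACA -[X in _ * X <= _]muleA [leLHS]muleA -!EFinM.
by rewrite [(K * r j * _)%R]mulrC mulrA.
Qed.

End residual_chain.

(** * Hitting times as events and as series *)

Section hitting_times.
Context (R : realType).

Lemma le_inf_time (D : set nat) k :
  (k%:R%:E <= inf_time R D) = `[< forall i, D i -> (k <= i)%N >].
Proof.
apply/idP/asboolP => [kD i Di|kD].
  rewrite -(ler_nat R) -lee_fin; apply: le_trans kD _.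
  by apply: ereal_inf_lbound; exists i.
by apply: le_ereal_inf_tmp => _ [i Di <-]; rewrite lee_fin ler_nat kD.
Qed.

Lemma inf_time_min (D : set nat) k : D k -> (forall i, D i -> (k <= i)%N) ->
  inf_time R D = k%:R%:E.
Proof.
move=> Dk kD; apply/eqP; rewrite eq_le le_inf_time; apply/andP; split.
  by apply: ereal_inf_lbound; exists k.
exact/asboolP.
Qed.

(** Only the minimum of [D] contributes to the series. If [D] is empty, the time is +oo and both
    sides are 0. *)
Lemma seq_at_inf_time (r : nat -> R) (D : set nat) : (forall n, (0 <= r n)%R) ->
  seq_at r (inf_time R D) =
  \sum_(k <oo) (r k)%:E * (\1_[set k | D k /\ forall i, D i -> (k <= i)%N] k)%:E.
Proof.
move=> r0; have [[k0 Dk0]|D0] := pselect (exists k, D k); last first.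
  rewrite eseries0 => [|k _ _]; last first.
    by rewrite indicE memNset ?mule0// => -[Dk _]; apply: D0; exists k.
  suff -> : D = set0 by rewrite /inf_time image_set0 ereal_inf0.
  by apply/seteqP; split=> // k Dk; apply: D0; exists k.
have ex : exists k, `[< D k >] by exists k0; exact/asboolP.
case: (ex_minnP ex) => k /asboolP Dk kmin.
have kD i : D i -> (k <= i)%N by move=> Di; apply: kmin; exact/asboolP.
rewrite (inf_time_min Dk kD) /= natrK.
rewrite (nneseriesD1 (n := k))//; last first.
  by move=> i _; rewrite mule_ge0// lee_fin.
rewrite indicE mem_set// mule1 eseries0 ?adde0// => i _ /andP[_ ik].
rewrite indicE memNset ?mule0// => -[Di iD].
by move: ik; rewrite eqn_leq kD ?iD.
Qed.

End hitting_times.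
Lemma le_return_time (R : realType) (Om X : Type) (C : set X)
    (Y : nat -> Om -> X) w k :
  (k%:R%:E <= return_time R C Y w) = (w \in stays_in Y (~` C) 1 k).
Proof.
rewrite le_inf_time; apply/asboolP/idP => [h|/set_mem h i [i1 Ci]].
  apply: mem_set => i /andP[i1 ik] Ci.
  by have := h i (conj i1 Ci); rewrite leqNgt ik.
by rewrite leqNgt; apply/negP => ik; apply: (h i) => //; rewrite i1.
Qed.

Lemma le_regeneration_time (R : realType) (Om X : Type)
    (Z : nat -> Om -> X * bool) w k :
  (k%:R%:E <= regeneration_time R Z w) =
  (w \in stays_in Z [set z | ~~ z.2] 0 k).
Proof.
rewrite le_inf_time; apply/asboolP/idP => [h|/set_mem h i Zi].
  apply: mem_set => i /= ik; apply/negP => Zi.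
  by have := h i Zi; rewrite leqNgt ik.
by rewrite leqNgt; apply/negP => ik; have /negP := h i ik; apply.
Qed.

(** Regeneration occurs at k exactly when the coin shows 0 before k and 1 at k. Each term thus has
    the form treated by [killed_split_chain]. *)
Lemma seq_at_regeneration_time (R : realType) (Om X : Type)
    (Z : nat -> Om -> X * bool) (r : nat -> R) w : (forall n, (0 <= r n)%R) ->
  seq_at r (regeneration_time R Z w) =
  \sum_(k <oo) (r k)%:E * ((\1_(stays_in Z [set z | ~~ z.2] 0 k) w)%:E *
    (\1_[set z : X * bool | z.2] (Z k w))%:E).
Proof.
move=> r0; rewrite seq_at_inf_time//; apply: eq_eseriesr => k _; congr (_ * _).
rewrite -EFinM !indicE -(@le_regeneration_time R) le_inf_time -natrM mulnb.
congr (_%:R%:E); congr nat_of_bool; apply/idP/andP => [/set_mem[Zk kmin]|].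
  by split; [exact/asboolP|exact: mem_set].
by move=> [/asboolP kmin /set_mem Zk]; apply: mem_set.
Qed.

(** * The series for W *)

Section return_series.
Context d (X : measurableType d) (R : realType).
Variables (P : R.-pker X ~> X) (eps : R) (C : set X) (nu : probability X R).
Hypothesis mC : measurable C.
Variable Q : X -> {measure set X -> \bar R}.
Hypothesis QE : forall x A, measurable A -> Q x A = residual_kernel eps C P nu x A.
Hypothesis mQ : forall A, measurable A -> measurable_fun setT (Q ^~ A).

Lemma W_series dY (Om : measurableType dY) (Pt : X -> probability Om R)
    (Y : nat -> Om -> X) (r : nat -> R) (g : X -> R) x :
  markov_chain (Pt x) \d_x (residual_kernel eps C P nu) Y ->
  (forall n, (0 <= r n)%R) -> nonneg_measurable (EFin \o g) ->
  W Pt Y C r g x =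
  \sum_(i <oo) (r i.+1)%:E * \int[Q x]_u iter i (killed_on_C C Q) (EFin \o g) u.
Proof.
move=> hY r0 ng.
have nC := measurableC mC.
pose F k w := (\1_(stays_in Y (~` C) 1 k.+1) w : R)%:E * (EFin \o g) (Y k.+1 w).
have nF k : nonneg_measurable (F k) by exact: (nonneg_measurable_killed hY).
have rF0 k w : 0 <= (r k.+1)%:E * F k w.
  by rewrite mule_ge0 ?lee_fin//; exact: (nF k).2.
transitivity (\int[Pt x]_w \sum_(k <oo) (r k.+1)%:E * F k w).
  apply: eq_integral => w _; rewrite eseries_mkcond.
  (* The sum in W starts at k = 1, so it is reindexed by k - 1, which explains the weights
     [r i.+1]. *)
  pose G k := if k%:R%:E <= return_time R C Y w then (r k * g (Y k w))%:E else 0.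
  have G0 k : 0 <= G k.
    rewrite /G; case: ifP => // _; rewrite lee_fin mulr_ge0// -lee_fin.
    exact: ng.2.
  rewrite -(nneseries_addn (f := G) 1)//; apply: eq_eseriesr => k _.
  rewrite /G addn1 le_return_time /F indicE; case: (_ \in _).
    by rewrite mul1e EFinM.
  by rewrite mul0e mule0.
rewrite integral_weighted_nneseries//; apply: eq_eseriesr => k _.
by rewrite (killed_residual_chain mC QE mQ k hY).
Qed.

End return_series.

(** * From partial sums to the inequality for expectations *)

Theorem proposition2 (R : realType) (d : measure_display)
    (X : measurableType d) (hX : countably_generated X)
    (P : R.-pker X ~> X) (hP : positive_harris_recurrent P)
    (eps : R) (eps_gt0 : (0 < eps)%R) (eps_le1 : (eps <= 1)%R)
    (C : set X) (mC : measurable C)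
    (nu : probability X R) (nuC : nu C = 1)
    (hmin : forall (x : X) (A : set X), C x -> measurable A ->
      eps%:E * nu A <= P x A)
    (r : nat -> R) (r_ge0 : forall n : nat, (0 <= r n)%R)
    (K : R) (hK : forall n m : nat, (r (n + m)%N <= K * r n * r m)%R)
    (g : X -> R) (mg : measurable_fun setT g) (g_ge1 : forall x, (1 <= g x)%R)
    (dY : measure_display) (OmY : measurableType dY)
    (Pt : X -> probability OmY R) (Y : nat -> OmY -> X)
    (hY : forall x : X,
      markov_chain (Pt x) \d_x (residual_kernel eps C P nu) Y)
    (x : X)
    (dZ : measure_display) (OmZ : measurableType dZ)
    (Pc : probability OmZ R) (Z : nat -> OmZ -> X * bool)
    (hZ : markov_chain Pc (split_measure eps C \d_x)
      (split_kernel eps C P nu) Z) :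
  \int[Pc]_w (\sum_(0 <= k <oo | (k%:R%:E <= regeneration_time R Z w)%E)
      (r k * g (Z k w).1)%:E)
  <= (r 0%N * g x)%:E
     + W Pt Y C r g x * (\1_(~` C) x)%:E
     + (eps^-1 * (1 - eps) * K)%:E
       * ereal_sup [set W Pt Y C r g y | y in C]
       * \int[Pc]_w seq_at r (regeneration_time R Z w).
Proof.
have ng : nonneg_measurable (EFin \o g).
  split=> [|y]; first exact/measurable_EFinP.
  by rewrite lee_fin (le_trans ler01).
have [Q QE] := choice (residual_kernel_is_measure eps_le1 hmin).
have mQ A : measurable A -> measurable_fun setT (Q ^~ A).
  move=> mA; rewrite (_ : Q ^~ A = residual_kernel eps C P nu ^~ A).
    exact: measurable_residual_kernel.
  by apply/funext => y; exact: QE.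
pose Phi := killed_by_split eps C Q.
have mD := @measurable_bool_snd _ X negb.
have mR : measurable [set z : X * bool | z.2] := @measurable_bool_snd _ X id.
have ngZ : nonneg_measurable (fun z : X * bool => (g z.1)%:E).
  by split=> [|z]; [exact: measurableT_comp ng.1 measurable_fst|exact: ng.2].
have nR := nonneg_measurable_indic R mR.
have splitE f n := killed_split_chain (f := f) eps_gt0 eps_le1 mC QE mQ n hZ.
(* As g ignores the coin, the two coin weights add up to 1. *)
have average_g : split_average eps C (fun z => (g z.1)%:E) = EFin \o g.
  apply/funext => y; rewrite /split_average /= -!EFinM -EFinD -mulrDl.
  by rewrite subrK mul1r.
have average_R : split_average eps C (fun z => (\1_[set z : X * bool | z.2] z)%:E) =
    fun y => (eps * \1_C y)%:E.
  apply/funext => y; rewrite /split_average.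
  have -> : \1_[set z : X * bool | z.2] (y, false) = 0%R :> R.
    by rewrite indicE memNset.
  have -> : \1_[set z : X * bool | z.2] (y, true) = 1%R :> R.
    by rewrite indicE mem_set.
  by rewrite mule0 mule1 add0e.
have nepsC : nonneg_measurable (fun y => (eps * \1_C y)%:E).
  by under eq_fun do rewrite EFinM; apply: nonneg_measurableZ;
    [rewrite lee_fin ltW|exact: nonneg_measurable_indic].
have lhsE : \int[Pc]_w (\sum_(0 <= k <oo | (k%:R%:E <= regeneration_time R Z w)%E)
    (r k * g (Z k w).1)%:E) = \sum_(k <oo) (r k)%:E * iter k Phi (EFin \o g) x.
  transitivity (\int[Pc]_w \sum_(k <oo) (r k)%:E *
      ((\1_(stays_in Z [set z | ~~ z.2] 0 k) w)%:E * (g (Z k w).1)%:E)).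
    apply: eq_integral => w _; rewrite eseries_mkcond; apply: eq_eseriesr => k _.
    rewrite le_regeneration_time indicE; case: (_ \in _).
      by rewrite mul1e EFinM.
    by rewrite mul0e mule0.
  rewrite integral_weighted_nneseries//; last first.
    by move=> k; exact: (nonneg_measurable_killed hZ 0 k mD ngZ).
  by apply: eq_eseriesr => k _; have := splitE _ k ngZ; rewrite average_g => ->.
pose E := \int[Pc]_w seq_at r (regeneration_time R Z w).
have EE : E = \sum_(k <oo) (r k)%:E * iter k Phi (fun y => (eps * \1_C y)%:E) x.
  rewrite /E; under eq_integral do rewrite seq_at_regeneration_time//.
  rewrite integral_weighted_nneseries//; last first.
    by move=> k; exact: (nonneg_measurable_killed hZ 0 k mD nR).
  by apply: eq_eseriesr => k _; have := splitE _ k nR; rewrite average_R => ->.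
have W0 y : 0 <= W Pt Y C r g y.
  apply: integral_ge0 => w _; apply: nneseries_ge0 => k _ _.
  by rewrite lee_fin mulr_ge0// (le_trans ler01).
have kPhi n := kernel_operator_iter n (kernel_operator_killed_by_split eps_le1 mC mQ).
have nPhi f n : nonneg_measurable f -> nonneg_measurable (iter n Phi f).
  exact: (kop_nm (kPhi n)).
(* The bound [split_series_le] asks for K >= 0. If K < 0, then r(0) <= K r(0)^2 <= 0 forces r(0) =
   0, and r(n) <= K r(n) r(0) = 0 makes [r] vanish, so the left side is 0. *)
have [K0|Kneg] := leP 0%R K; last first.
  have r_eq0 n : r n = 0%R.
    have r0 : r 0%N = 0%R.
      apply/eqP; rewrite eq_le r_ge0 andbT (le_trans (hK 0%N 0%N))//.
      by rewrite -mulrA nmulr_rle0// mulr_ge0.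
    have := hK n 0%N; rewrite addn0 r0 mulr0 => rn0.
    by apply/eqP; rewrite eq_le rn0 r_ge0.
  rewrite lhsE -/E EE eseries0 => [|k _ _]; last by rewrite r_eq0 mul0e.
  rewrite eseries0 => [|k _ _]; last by rewrite r_eq0 mul0e.
  by rewrite mule0 adde0 r_eq0 mul0r add0e mule_ge0// lee_fin.
set M := ereal_sup _.
(* A supremum over an empty set would be -oo; since nu(C) = 1, [C] has a point and [M] is
   nonnegative. *)
have [c Cc] : exists c, C c.
  apply/not_existsP => nC; suff C0 : C = set0.
    by move: nuC; rewrite C0 measure0 => /esym/eqP; rewrite onee_eq0.
  by apply/seteqP; split=> // y /nC.
have leM y : C y -> W Pt Y C r g y <= M.
  by move=> Cy; apply: ereal_sup_ubound; exists y.
have M0 : 0 <= M by exact: le_trans (W0 c) (leM c Cc).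
have ler_W n y : \sum_(i < n) (r i.+1)%:E *
    \int[Q y]_u iter i (killed_on_C C Q) (EFin \o g) u <= W Pt Y C r g y.
  rewrite (W_series mC QE mQ (hY y))// -(big_mkord xpredT (fun i => (r i.+1)%:E *
    \int[Q y]_u iter i (killed_on_C C Q) (EFin \o g) u)).
  apply: nneseries_lim_ge => i _ _; rewrite mule_ge0 ?lee_fin//.
  apply: integral_ge0 => u _.
  exact: (kop_nm (kernel_operator_iter i (kernel_operator_killed_on_C mC mQ)) ng).2.
(* The right side does not depend on the truncation, so it is enough to bound each partial sum. *)
rewrite lhsE -/E; apply: lime_le.
  apply: is_cvg_nneseries => k _ _; rewrite mule_ge0 ?lee_fin//.
  exact: (nPhi _ _ ng).2.
apply: nearW => N; rewrite big_mkord.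
apply: le_trans (split_series_le eps_le1 mC mQ N r_ge0 K0 hK ng (W0 x) M0
  (ler_W ^~ x) (fun n y Cy => le_trans (ler_W n y) (leM y Cy))) _.
rewrite [_%:E * W _ _ _ _ _ _]muleC [(r 0%N * g x)%:E]EFinM leeD2l//.
(* Regeneration carries the weight eps 1_C, while [split_series_le] leaves 1_C; compensating for
   this produces the factor 1/eps. *)
have C_series :
    eps%:E * \sum_(n < N) (r n)%:E * iter n Phi (fun y => (\1_C y)%:E) x <= E.
  rewrite EE; apply: le_trans (nneseries_lim_ge N _); last first.
    move=> k _ _; rewrite mule_ge0 ?lee_fin//; exact: (nPhi _ _ nepsC).2.
  rewrite big_mkord ge0_sume_distrr; last first.
    move=> k _; rewrite mule_ge0 ?lee_fin//.
    exact: (nPhi _ _ (nonneg_measurable_indic R mC)).2.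
  apply: lee_sum => k _; rewrite muleCA -(kopZ (kPhi k))//.
    by rewrite lee_fin ltW.
  exact: nonneg_measurable_indic.
have -> : ((1 - eps) * K)%:E * M *
    (\sum_(n < N) (r n)%:E * iter n Phi (fun y => (\1_C y)%:E) x) =
    (eps^-1 * (1 - eps) * K)%:E * M *
    (eps%:E * \sum_(n < N) (r n)%:E * iter n Phi (fun y => (\1_C y)%:E) x).
  rewrite [RHS]muleACA -EFinM -[LHS]muleA; congr (_%:E * _).
  by rewrite [RHS]mulrC !mulrA mulfV ?mul1r// gt_eqF.
rewrite lee_wpmul2l// mule_ge0// lee_fin !mulr_ge0 ?invr_ge0 ?subr_ge0//.
exact: ltW.
Qed.
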